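(* Let $(M,Q)$ be a polarised Riemann surface, let $f:(M,Q)\to\mathbb{R}^n$ be isothermic with Christoffel transform $f^c$, let $r_1,r_2\in\mathbb{R}\setminus\{0\}$ and let $f_1=\mathcal{D}_{r_1}f$ and $f_2=\mathcal{D}_{r_2}f$ be distinct Darboux transforms of $f$. Then there is a fourth isothermic surface $\hat f$ with $$\hat f=\mathcal{D}_{r_2}f_1=\mathcal{D}_{r_1}f_2$$ (that is, $\hat f$ is simultaneously a Darboux transform of $f_1$ with parameter $r_2$ and of $f_2$ with parameter $r_1$) such that corresponding points of $f,f_1,\hat f,f_2$ are concircular with real cross-ratio $r_2/r_1$, i.e. $C(f,f_1,\hat f,f_2)=r_2/r_1$ pointwise.
   Context: $C\ell_n$ is the real Clifford algebra of Euclidean $\mathbb{R}^n$, with $vw+wv=-2(v,w)1$ for $v,w\in\mathbb{R}^n$; nonzero vectors are invertible. For $C\ell_n$-valued 1-forms, $(\alpha\wedge\beta)(X,Y)=\alpha(X)\beta(Y)-\alpha(Y)\beta(X)$. A polarised Riemann surface $(M,Q)$ is a Riemann surface $M$ with a nonzero holomorphic quadratic differential $Q$. For $\mathbb{R}^n$-valued 1-forms, $(\alpha,\beta)^{2,0}=(\alpha(\partial_z),\beta(\partial_z))\,dz^2$ (complex bilinear extension). A conformal immersion $f:(M,Q)\to\mathbb{R}^n$ is isothermic if there is a map $f^c:M\to\mathbb{R}^n$ with $df\wedge df^c=0$ and $(df,df^c)^{2,0}=Q$; $f^c$ is unique up to translation and called the Christoffel transform of $f$. For $r\in\mathbb{R}\setminus\{0\}$,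 $\mathcal{D}_rf$ denotes any map $f+g$ where $g:M\to\mathbb{R}^n$ solves the Riccati equation $dg=r\,g\,df^c\,g-df$ (products in $C\ell_n$). A Darboux transform $f+g$ is isothermic on the same $(M,Q)$, with Christoffel transform $f^c+(rg)^{-1}$ (used to define its own Darboux transforms). The Clifford algebra cross-ratio is $C(v_0,v_1,v_2,v_3)=(v_0-v_1)(v_1-v_2)^{-1}(v_2-v_3)(v_3-v_0)^{-1}\in C\ell_n$. All maps are smooth, and statements are local: $M$ may be shrunk to an open simply connected set on which all maps involved exist, take finite values, and are pointwise distinct where inverses of their differences occur; transforms are immersions away from the (discrete) zeros of $Q$. Explicitly, writing $f_i=f+g_i$, one works where $g_1$, $g_2$, $g_1-g_2$ and $r_2g_1^{-1}-r_1g_2^{-1}$ are nonzero. *)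

(* Defs.v *)
From HB Require Import structures.
From mathcomp Require Import all_boot all_order all_algebra.
From mathcomp Require Import all_classical all_reals all_analysis.
From mathcomp Require Import complex ring.

Set Implicit Arguments.
Unset Strict Implicit.
Unset Printing Implicit Defensive.

Import Order.TTheory GRing.Theory Num.Theory numFieldNormedType.Exports.

Local Open Scope classical_set_scope.
Local Open Scope ring_scope.
Local Open Scope complex_scope.

Definition dot (K : pzRingType) (n : nat) (u v : 'rV[K]_n) : K :=
  \sum_i u 0 i * v 0 i.

(* The real Clifford algebra of R^n, on the basis e_A indexed by the subsets
   A of 'I_n, where e_A is the increasing product of the e_i (i \in A).
   Reordering e_A e_B costs a sign for each pair (i, j) in A x B with j < i, and
   e_i e_i = -1 costs a sign for each pair with i = j, so
   e_A e_B = (-1)^#{(i, j) in A x B | j <= i} e_(A symdiff B). *)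
Section SymmetricDifference.
Variable n : nat.
Implicit Types A B C : {set 'I_n}.

Definition symdiff A B : {set 'I_n} := [set i | (i \in A) (+) (i \in B)]%SET.

Definition cl_count A B : nat :=
  #|[set p : 'I_n * 'I_n | [&& p.1 \in A, p.2 \in B & p.2 <= p.1]%N]%SET|.

Lemma symdiffA : associative symdiff.
Proof. by move=> A B C; apply/setP => i; rewrite !inE addbA. Qed.

Lemma symdiffC : commutative symdiff.
Proof. by move=> A B; apply/setP => i; rewrite !inE addbC. Qed.

Lemma symdiffK A : cancel (symdiff A) (symdiff A).
Proof. by move=> B; apply/setP => i; rewrite !inE addKb. Qed.

Lemma symdiff0 A : symdiff A finset.set0 = A.
Proof. by apply/setP => i; rewrite !inE addbF. Qed.

Lemma symdiff_eq A B C : (symdiff A B == C) = (B == symdiff A C).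
Proof. by apply/eqP/eqP => [<-|->]; rewrite symdiffK. Qed.

Lemma odd_cl_count A B : odd (cl_count A B) =
  \big[addb/false]_p [&& p.1 \in A, p.2 \in B & p.2 <= p.1]%N.
Proof.
rewrite /cl_count -sum1_card (big_morph odd oddD (erefl _)) big_mkcond /=.
by apply: eq_bigr => p _; rewrite inE; case: ifP.
Qed.

Lemma odd_cl_countl A A' B :
  odd (cl_count (symdiff A A') B) = odd (cl_count A B) (+) odd (cl_count A' B).
Proof.
rewrite !odd_cl_count -big_split /=; apply: eq_bigr => p _.
by rewrite inE; case: (p.1 \in A); case: (p.1 \in A') => //=; rewrite ?addbb ?addbF.
Qed.

Lemma odd_cl_countr A B B' :
  odd (cl_count A (symdiff B B')) = odd (cl_count A B) (+) odd (cl_count A B').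
Proof.
rewrite !odd_cl_count -big_split /=; apply: eq_bigr => p _; rewrite inE.
by case: (p.1 \in A); case: (p.2 \in B); case: (p.2 \in B'); case: (p.2 <= p.1)%N.
Qed.

End SymmetricDifference.

Definition clifford (R : realType) (n : nat) : Type := {ffun {set 'I_n} -> R}.

Section Clifford.
Variables (R : realType) (n : nat).
Implicit Types (x y z : clifford R n) (A B C : {set 'I_n}).

HB.instance Definition _ :=
  GRing.Lmodule.copy (clifford R n) {ffun {set 'I_n} -> R^o}.

Definition cl_basis A : clifford R n := [ffun B => (B == A)%:R].

Definition cl_mul x y : clifford R n :=
  [ffun C => \sum_A \sum_(B | symdiff A B == C)
               (-1) ^+ cl_count A B * (x A * y B)].

Lemma cl_mulE x y C : cl_mul x y C =
  \sum_A (-1) ^+ cl_count A (symdiff A C) * (x A * y (symdiff A C)).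
Proof.
rewrite ffunE; apply: eq_bigr => A _.
by rewrite (big_pred1 (symdiff A C)) // => B; rewrite symdiff_eq.
Qed.

Lemma cl_mulA : associative cl_mul.
Proof.
move=> x y z; apply/ffunP => C; rewrite !cl_mulE.
under eq_bigr => A _ do rewrite cl_mulE mulr_sumr mulr_sumr.
under [RHS]eq_bigr => D _ do rewrite cl_mulE mulr_suml mulr_sumr.
rewrite [RHS]exchange_big; apply: eq_bigr => A _ /=.
rewrite [RHS](reindex_inj (can_inj (symdiffK A))); apply: eq_bigr => B _ /=.
rewrite symdiffK.
have -> : symdiff (symdiff A B) C = symdiff B (symdiff A C).
  by rewrite symdiffA (symdiffC A).
have s : (-1) ^+ cl_count A (symdiff A C) *
         (-1) ^+ cl_count B (symdiff B (symdiff A C)) =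
         (-1) ^+ cl_count (symdiff A B) (symdiff B (symdiff A C)) *
         (-1) ^+ cl_count A B :> R.
  rewrite -!exprD -[LHS]signr_odd -[RHS]signr_odd; congr (_ ^+ nat_of_bool _).
  rewrite !oddD !(odd_cl_countl, odd_cl_countr).
  move: (odd (cl_count A A)) (odd (cl_count A B)) (odd (cl_count A C)).
  move: (odd (cl_count B A)) (odd (cl_count B B)) (odd (cl_count B C)).
  by do 6![case].
set X := x A; set Y := y B; set Z := z _.
transitivity ((-1) ^+ cl_count A (symdiff A C) *
  (-1) ^+ cl_count B (symdiff B (symdiff A C)) * (X * Y * Z)); first by ring.
by rewrite s; ring.
Qed.

Lemma cl_mulBasis A B :
  cl_mul (cl_basis A) (cl_basis B) =
  (-1) ^+ cl_count A B *: cl_basis (symdiff A B).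
Proof.
apply/ffunP => C; rewrite cl_mulE (bigD1 A) //= big1 => [|D /negPf DA]; last first.
  by rewrite !ffunE DA mul0r mulr0.
rewrite addr0 !ffunE eqxx mul1r (can2_eq (symdiffK A) (symdiffK A)).
by case: (eqVneq C (symdiff A B)) => [->|_]; rewrite ?symdiffK // !mulr0 ?scaler0.
Qed.

Lemma cl_count0l A : cl_count finset.set0 A = 0%N.
Proof. by apply: eq_card0 => p; rewrite !inE. Qed.

Lemma cl_count0r A : cl_count A finset.set0 = 0%N.
Proof. by apply: eq_card0 => p; rewrite !inE andbF. Qed.

Lemma cl_mul1l : left_id (cl_basis finset.set0) cl_mul.
Proof.
move=> x; apply/ffunP => C; rewrite cl_mulE (bigD1 finset.set0) //= big1.
  by rewrite cl_count0l ffunE eqxx !mul1r addr0 symdiffC symdiff0.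
by move=> D /negPf D0; rewrite !ffunE D0 mul0r mulr0.
Qed.

Lemma cl_mul1r : right_id (cl_basis finset.set0) cl_mul.
Proof.
move=> x; apply/ffunP => C; rewrite cl_mulE (bigD1 C) //= big1.
  have -> : symdiff C C = finset.set0.
    by rewrite -[X in symdiff _ X]symdiff0 symdiffK.
  by rewrite cl_count0r ffunE eqxx mul1r mulr1 addr0.
move=> D /negPf DC; rewrite !ffunE (can2_eq (symdiffK D) (symdiffK D)).
by rewrite symdiff0 eq_sym DC mulr0 mulr0.
Qed.

Lemma cl_mulDl : left_distributive cl_mul +%R.
Proof.
move=> x y z; apply/ffunP => C; rewrite [RHS]ffunE !cl_mulE -big_split /=.
by apply: eq_bigr => A _; rewrite ffunE; ring.
Qed.

Lemma cl_mulDr : right_distributive cl_mul +%R.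
Proof.
move=> x y z; apply/ffunP => C; rewrite [RHS]ffunE !cl_mulE -big_split /=.
by apply: eq_bigr => A _; rewrite ffunE; ring.
Qed.

Lemma cl_oner_neq0 : cl_basis finset.set0 != 0.
Proof.
by apply/eqP => /ffunP/(_ finset.set0)/eqP; rewrite !ffunE eqxx oner_eq0.
Qed.

HB.instance Definition _ := GRing.Zmodule_isNzRing.Build (clifford R n)
  cl_mulA cl_mul1l cl_mul1r cl_mulDl cl_mulDr cl_oner_neq0.

Lemma cl_scaleAl (a : R) x y : a *: (x * y) = a *: x * y.
Proof.
apply/ffunP => C; rewrite ffunE [in RHS]/GRing.mul/= !cl_mulE scaler_sumr.
by apply: eq_bigr => A _; rewrite ffunE /GRing.scale/=; ring.
Qed.

HB.instance Definition _ :=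
  GRing.Lmodule_isLalgebra.Build R (clifford R n) cl_scaleAl.

Lemma cl_scaleAr (a : R) x y : a *: (x * y) = x * (a *: y).
Proof.
apply/ffunP => C; rewrite ffunE [in RHS]/GRing.mul/= !cl_mulE scaler_sumr.
by apply: eq_bigr => A _; rewrite ffunE /GRing.scale/=; ring.
Qed.

HB.instance Definition _ :=
  GRing.Lalgebra_isAlgebra.Build R (clifford R n) cl_scaleAr.

(* Two-sided inverses; x^-1 is x when x is not a unit. *)
Definition cl_unit : pred (clifford R n) :=
  fun x => `[< exists y, y * x = 1 /\ x * y = 1 >].

Definition cl_inv x : clifford R n := xget x [set y | y * x = 1 /\ x * y = 1].

Lemma cl_invP x : cl_unit x -> cl_inv x * x = 1 /\ x * cl_inv x = 1.
Proof. by move=> /asboolP[y xy]; rewrite /cl_inv; case: xgetP => // /(_ y). Qed.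

Lemma cl_mulVr : {in cl_unit, left_inverse 1 cl_inv *%R}.
Proof. by move=> x /cl_invP[]. Qed.

Lemma cl_mulrV : {in cl_unit, right_inverse 1 cl_inv *%R}.
Proof. by move=> x /cl_invP[]. Qed.

Lemma cl_unitP x y : y * x = 1 /\ x * y = 1 -> cl_unit x.
Proof. by move=> xy; apply/asboolP; exists y. Qed.

Lemma cl_inv_out : {in [predC cl_unit], cl_inv =1 id}.
Proof.
move=> x /negP xU; rewrite /cl_inv; case: xgetP => // y _ xy.
by case: xU; apply/asboolP; exists y.
Qed.

HB.instance Definition _ := GRing.NzRing_hasMulInverse.Build (clifford R n)
  cl_mulVr cl_mulrV cl_unitP cl_inv_out.

Definition cl_vec (v : 'rV[R]_n) : clifford R n :=
  \sum_i v 0 i *: cl_basis [set i]%SET.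

Lemma cl_vecD v w : cl_vec (v + w) = cl_vec v + cl_vec w.
Proof.
by rewrite -big_split; apply: eq_bigr => i _; rewrite mxE scalerDl.
Qed.

Lemma cl_vecZ a v : cl_vec (a *: v) = a *: cl_vec v.
Proof.
by rewrite scaler_sumr; apply: eq_bigr => i _; rewrite mxE scalerA.
Qed.

Lemma cl_basis_anticomm i j :
  cl_basis [set i]%SET * cl_basis [set j]%SET +
  cl_basis [set j]%SET * cl_basis [set i]%SET =
  (- 2 * (i == j)%:R) *: 1.
Proof.
have cE (k l : 'I_n) : cl_count [set k]%SET [set l]%SET = (l <= k)%N.
  rewrite /cl_count; case: (leqP l k) => kl.
    rewrite -[RHS](cards1 (k, l)); apply: eq_card => -[p q].
    by rewrite !inE -pair_eqE /=; case: eqP => // ->; case: eqP => // ->.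
  apply: eq_card0 => -[p q]; rewrite !inE /=.
  by case: eqP => // ->; case: eqP => // ->; rewrite leqNgt kl.
have bE := cl_mulBasis : forall A B, cl_basis A * cl_basis B = _.
rewrite !bE !cE (symdiffC [set j]%SET).
have [->|ij] := eqVneq i j.
  rewrite leqnn; have -> : symdiff [set j]%SET [set j]%SET = finset.set0.
    by rewrite -[X in symdiff _ X]symdiff0 symdiffK.
  by rewrite -scalerDl; congr (_ *: _); rewrite expr1 mulr1; ring.
have : (i : nat) != j by [].
rewrite neq_ltn mulr0 scale0r => /orP[] h;
  rewrite (ltnW h) (ltn_geF h) -scalerDl /= expr0 expr1 ?subrr ?addNr;
  by rewrite scale0r.
Qed.

Lemma cl_vec_anticomm v w :
  cl_vec v * cl_vec w + cl_vec w * cl_vec v = (- 2 * dot v w) *: 1.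
Proof.
have mE u u' : cl_vec u * cl_vec u' = \sum_i \sum_j
    (u 0 i * u' 0 j) *: (cl_basis [set i]%SET * cl_basis [set j]%SET).
  rewrite mulr_suml; apply: eq_bigr => i _; rewrite mulr_sumr.
  by apply: eq_bigr => j _; rewrite -scalerAr -scalerAl scalerA mulrC.
rewrite !mE [X in _ + X]exchange_big -big_split /= /dot mulr_sumr scaler_suml.
apply: eq_bigr => i _; rewrite -big_split /= (bigD1 i) //= big1 => [|j ji].
  rewrite addr0 [w 0 i * _]mulrC -scalerDr cl_basis_anticomm eqxx mulr1 scalerA.
  by rewrite mulrC.
rewrite [w 0 j * _]mulrC -scalerDr cl_basis_anticomm eq_sym (negPf ji).
by rewrite mulr0 scale0r scaler0.
Qed.

(* The inverse -v / (v, v) of v in the Clifford algebra, as a vector. *)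
Definition vec_inv (v : 'rV[R]_n) : 'rV[R]_n := - (dot v v)^-1 *: v.

Lemma dot_eq0 (v : 'rV[R]_n) : (dot v v == 0) = (v == 0).
Proof.
rewrite /dot psumr_eq0 => [|i _]; last by rewrite -expr2 sqr_ge0.
apply/allP/eqP => [v0|-> i _]; last by rewrite /= mxE mul0r eqxx.
apply/rowP => i; have /implyP/(_ isT) := v0 i (mem_index_enum i).
by rewrite mxE mulf_eq0 orbb => /eqP.
Qed.

Lemma cl_vec_sqr v : cl_vec v * cl_vec v = - dot v v *: 1.
Proof.
have := cl_vec_anticomm v v; rewrite -mulr2n -scaler_nat.
move=> /(congr1 ( *:%R (2^-1))); rewrite !scalerA mulVf // scale1r => ->.
by congr (_ *: _); field.
Qed.

Lemma cl_vec_inv v : v != 0 -> (cl_vec v)^-1 = cl_vec (vec_inv v).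
Proof.
rewrite -dot_eq0 => v0.
have vv : cl_vec (vec_inv v) * cl_vec v = 1 /\ cl_vec v * cl_vec (vec_inv v) = 1.
  rewrite cl_vecZ -scalerAl -scalerAr cl_vec_sqr scalerA mulrNN mulVf //.
  by rewrite scale1r.
have vU : cl_vec v \is a GRing.unit by apply/unitrP; exists (cl_vec (vec_inv v)).
by apply: (mulIr vU); rewrite mulVr // (proj1 vv).
Qed.

End Clifford.

Section Calculus.
Variables (R : realType) (W : normedModType R).
Local Notation C := (R[i]^o).

Definition cline (z X : C) (t : R) : C := z + t%:C * X.

(* The differential of F : C -> W at z, C being the real plane, applied to the
   tangent vector X. *)
Definition dmap (F : C -> W) (z X : C) : W := derive1 (F \o cline z X) 0.

(* F is of class C^k on V, which is meant to be open. *)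
Fixpoint Ck (k : nat) (V : set C) (F : C -> W) : Prop :=
  {in V, continuous F} /\
  (if k is k'.+1 then forall X : C,
     (forall z, V z -> derivable (F \o cline z X) 0 1) /\
     Ck k' V (fun z => dmap F z X)
   else True).

Definition smooth (V : set C) (F : C -> W) : Prop := forall k, Ck k V F.

End Calculus.

Definition holomorphic (R : realType) (V : set R[i]^o) (q : R[i]^o -> R[i]^o) :
  Prop := forall z, V z -> derivable q z 1.

(* [chart_inv] is only meaningful on the open set [chart_map @` chart_dom]. *)
Record chart (R : realType) (M : topologicalType) := Chart {
  chart_dom : set M;
  chart_map : M -> R[i]^o;
  chart_inv : R[i]^o -> M;
  chart_dom_open : open chart_dom;
  chart_img_open : open (chart_map @` chart_dom);
  chart_map_cont : {in chart_dom, continuous chart_map};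
  chart_inv_cont : {in chart_map @` chart_dom, continuous chart_inv};
  chart_mapK : {in chart_dom, cancel chart_map chart_inv} }.

Definition chart_img (R : realType) (M : topologicalType) (c : chart R M) :
  set R[i]^o := chart_map c @` chart_dom c.

Definition chart_overlap (R : realType) (M : topologicalType)
  (c d : chart R M) : set R[i]^o :=
  chart_map c @` (chart_dom c `&` chart_dom d).

Definition transition (R : realType) (M : topologicalType)
  (c d : chart R M) : R[i]^o -> R[i]^o := chart_map d \o chart_inv c.

Record riemannSurface (R : realType) := RiemannSurface {
  surface :> topologicalType;
  atlas : set (chart R surface);
  surface_hausdorff : hausdorff_space surface;
  surface_connected : connected [set: surface];
  atlas_cover : forall p, exists2 c, atlas c & chart_dom c p;
  atlas_holomorphic : forall c d, atlas c -> atlas d ->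
    holomorphic (chart_overlap c d) (transition c d) }.

(* A holomorphic quadratic differential, equal to [quad_coef c z dz^2] in the
   chart c. *)
Record quadDiff (R : realType) (M : riemannSurface R) := QuadDiff {
  quad_coef : chart R M -> R[i]^o -> R[i]^o;
  quad_holomorphic : forall c, atlas c ->
    holomorphic (chart_img c) (quad_coef c);
  quad_transition : forall c d, atlas c -> atlas d ->
    forall z, chart_overlap c d z ->
      quad_coef c z =
      quad_coef d (transition c d z) * derive1 (transition c d) z ^+ 2 }.

Definition quad_nonzero (R : realType) (M : riemannSurface R)
  (Q : quadDiff M) : Prop :=
  exists c z, [/\ atlas c, chart_img c z & quad_coef Q c z != 0].

Section Surfaces.
Variables (R : realType) (n : nat) (M : riemannSurface R).
Local Notation C := (R[i]^o).
Implicit Types (f g fc : M -> 'rV[R]_n) (c : chart R M) (z X Y : C).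

Definition on_charts (P : chart R M -> C -> Prop) : Prop :=
  forall c z, atlas c -> chart_img c z -> P c z.

Definition smooth_map f : Prop :=
  forall c, atlas c -> smooth (chart_img c) (f \o chart_inv c).

(* df at the point of coordinate z in the chart c. *)
Definition dform f c z X : 'rV[R]_n := dmap (f \o chart_inv c) z X.

Definition cl_dform f c z X : clifford R n := cl_vec (dform f c z X).

Definition cl_wedge (a b : C -> clifford R n) X Y : clifford R n :=
  a X * b Y - a Y * b X.

(* df(d/dz) = (df(d/dx) - i df(d/dy)) / 2 *)
Definition dform_dz f c z : 'rV[R[i]]_n :=
  2^-1 *: (map_mx (real_complex R) (dform f c z 1) -
           (0 +i* 1) *: map_mx (real_complex R) (dform f c z (0 +i* 1))).

Definition conformal_immersion f : Prop :=
  smooth_map f /\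
  on_charts (fun c z => exists2 l : R, 0 < l & forall X Y,
    dot (dform f c z X) (dform f c z Y) =
    l * (complex.Re X * complex.Re Y + complex.Im X * complex.Im Y)).

Definition is_christoffel (Q : quadDiff M) f fc : Prop :=
  [/\ smooth_map fc,
      on_charts (fun c z => forall X Y,
        cl_wedge (cl_dform f c z) (cl_dform fc c z) X Y = 0) &
      on_charts (fun c z =>
        dot (dform_dz f c z) (dform_dz fc c z) = quad_coef Q c z)].

Definition isothermic (Q : quadDiff M) f : Prop :=
  conformal_immersion f /\ exists fc, is_christoffel Q f fc.

Definition riccati (r : R) f fc g : Prop :=
  on_charts (fun c z => forall X,
    let gz := cl_vec (g (chart_inv c z)) in
    cl_dform g c z X = r *: (gz * cl_dform fc c z X * gz) - cl_dform f c z X).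

(* fh is a Darboux transform D_r f, where fc is the Christoffel transform
   of f. *)
Definition is_darboux (r : R) f fc fh : Prop :=
  exists g, [/\ smooth_map g, riccati r f fc g &
                forall p, fh p = f p + g p].

(* The Christoffel transform fc + (r g)^-1 of the Darboux transform fh = f + g
   (see cl_vec_inv for the inverse). *)
Definition darboux_christoffel (r : R) f fc fh : M -> 'rV[R]_n :=
  fun p => fc p + vec_inv (r *: (fh p - f p)).

End Surfaces.

Section CrossRatio.
Variables (R : realType) (n : nat).
Implicit Types v : 'rV[R]_n.

Definition cross_ratio v0 v1 v2 v3 : clifford R n :=
  cl_vec (v0 - v1) * (cl_vec (v1 - v2))^-1 *
  cl_vec (v2 - v3) * (cl_vec (v3 - v0))^-1.

Definition line_set (A : set 'rV[R]_n) : Prop :=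
  exists p u : 'rV[R]_n, u != 0 /\ A = [set p + t *: u | t in [set: R]].

Definition circle_set (A : set 'rV[R]_n) : Prop :=
  exists (p u v : 'rV[R]_n) (rho : R),
    [/\ dot u u = 1, dot v v = 1, dot u v = 0, 0 < rho &
        A = [set p + s.1 *: u + s.2 *: v |
              s in [set s : R * R | s.1 ^+ 2 + s.2 ^+ 2 = rho ^+ 2]]].

(* Circles are those of Moebius geometry: straight lines are included. *)
Definition concircular v0 v1 v2 v3 : Prop :=
  exists A, (circle_set A \/ line_set A) /\ [/\ A v0, A v1, A v2 & A v3].

End CrossRatio.

(* Main.v *)
(* Write g_i = f_i - f, a = g_1^-1, b = g_2^-1, w = r2 a - r1 b. Prescribing the
   cross-ratio forces the fourth point to be f + (r2 - r1) w^-1. The Riccati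
   equations give da = - r1 df^c + a df a and db = - r2 df^c + b df b, so df^c drops
   out of dw = r2 a df a - r1 b df b, and the Riccati equation of the vector
   gh = (r2 - r1) w^-1 - a^-1 from f_1 to the fourth point reduces to an identity in
   noncommuting a, b and df. The formula for the fourth point is symmetric in the
   two transforms, so it is also a Darboux transform of f_2. Its differential is
   (r2 / r1) gh a df a gh: vectors act by sandwiching as scaled reflections, which
   makes the fourth surface a conformal immersion everywhere, even at the zeros of Q
   where f_1 and f_2 are not immersed. *)

Require Import Defs.
From HB Require Import structures.
From mathcomp Require Import all_boot all_order all_algebra.
From mathcomp Require Import all_classical all_reals all_analysis.
From mathcomp Require Import complex ring.

Set Implicit Arguments.
Unset Strict Implicit.
Unset Printing Implicit Defensive.

Import Order.TTheory GRing.Theory Num.Theory numFieldNormedType.Exports.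

Local Open Scope classical_set_scope.
Local Open Scope ring_scope.

(** * Product rules for derivatives of vector-valued functions of a real variable *)

Section LineDerivatives.
Variable R : realType.

(** The increment of [a *: F] splits as [a (t + h)] times the increment of [F] plus the increment of
    [a] times [F t], so the quotient converges once [a] is continuous at [t]. *)
Lemma is_derive_scale (W : normedModType R) (a : R -> R) (F : R -> W) (t : R)
  da dF :
  is_derive t 1 a da -> is_derive t 1 F dF ->
  is_derive t 1 (fun s => a s *: F s) (a t *: dF + da *: F t).
Proof.
move=> [a_der a_val] [F_der F_val].
have cv : (fun h => h^-1 *: (((fun s => a s *: F s) \o shift t) (h *: (1 : R))
    - a t *: F t)) @ 0^' --> a t *: dF + da *: F t.
  have -> : (fun h => h^-1 *: (((fun s => a s *: F s) \o shift t) (h *: (1 : R))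
    - a t *: F t)) = (fun h =>
    a (h *: (1 : R) + t) *: (h^-1 *: ((F \o shift t) (h *: (1 : R)) - F t)) +
    (h^-1 *: ((a \o shift t) (h *: (1 : R)) - a t)) *: F t).
    apply/funext => h /=; rewrite scalerA [_ * h^-1]mulrC -scalerA -scalerA.
    rewrite -scalerDr; congr (_ *: _).
    by rewrite scalerBr scalerBl subrKA.
  rewrite -a_val -F_val; apply: cvgD.
    apply: cvgZ; last exact: F_der.
    suff : {for 0, continuous (fun h : R => a (h *: (1 : R) + t))}.
      by move=> /continuous_withinNx; rewrite scale0r add0r.
    exact/differentiable_continuous/derivable1_diffP/(derivable1P _ _ _).1.
  by apply: cvgZ; [exact: a_der | exact: cvg_cst].
split; first by apply/cvg_ex; exists (a t *: dF + da *: F t).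
exact: cvg_lim cv.
Qed.

Lemma is_derive_coord m n (F : R -> 'M[R]_(m, n)) (t : R) dF i j :
  is_derive t 1 F dF -> is_derive t 1 (fun s => F s i j : R^o) (dF i j).
Proof.
move=> [F_der F_val]; split; first by move/derivable_mxP: F_der.
by rewrite -F_val derive_mx // mxE.
Qed.

Lemma is_derive_dot n (F G : R -> 'rV[R]_n) (t : R) dF dG :
  is_derive t 1 F dF -> is_derive t 1 G dG ->
  is_derive t 1 (fun s => dot (F s) (G s) : R^o) (dot (F t) dG + dot dF (G t)).
Proof.
move=> F_der G_der.
have -> : (fun s => dot (F s) (G s)) =
    \sum_i (fun s => F s 0 i *: (G s 0 i : R^o)).
  by apply/funext => s; rewrite fct_sumE.
rewrite /dot -big_split /=.
apply: is_derive_sum => i.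
exact: is_derive_scale (is_derive_coord _ _ _) (is_derive_coord _ _ _).
Qed.

End LineDerivatives.

(** * Derivatives along real lines in the complex plane *)

Section LinesAndCk.
Variable R : realType.
Local Notation C := (R[i]^o).
Implicit Types (V : set C) (z X : C).

Lemma continuous_cline z X : continuous (cline z X).
Proof.
move=> t; apply: cvgD; first exact: cvg_cst.
apply: (@cvgM R[i]); last exact: cvg_cst.
apply/cvgrPdist_lt => e e0.
(* The norm of [C] takes complex values, so the radius [e] is itself a complex number, real because
   it is positive. *)
have eE : e = (complex.Re e)%:C%C by rewrite RRe_real // gtr0_real.
rewrite eE in e0 *.
near=> s; rewrite -rmorphB /= normc_def /= expr0n addr0 sqrtr_sqr ltcR.
near: s; move: e0; rewrite ltcR => e0.
exact: (@cvgr_dist_lt _ _ _ (nbhs t) _ id t).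
Unshelve. all: by end_near. Qed.

Lemma cline0 z X : cline z X 0 = z.
Proof. by rewrite /cline mul0r addr0. Qed.

Lemma near_cline V z X : open V -> V z -> \forall t \near (0 : R), V (cline z X t).
Proof.
move=> oV Vz; apply: (@continuous_cline z X 0).
by apply: open_nbhs_nbhs; rewrite cline0.
Qed.

(** Bundles existence of the directional derivative with its value: [dmap] is a limit, and carries
    no information where that limit does not exist. *)
Definition is_dmap (W : normedModType R) (F : C -> W) z X (dF : W) :=
  is_derive (0 : R) 1 (F \o cline z X) dF.

Lemma dmapE (W : normedModType R) (F : C -> W) z X dF :
  is_dmap F z X dF -> dmap F z X = dF.
Proof. by case=> _; rewrite /dmap derive1E. Qed.

Lemma is_dmapP (W : normedModType R) (F : C -> W) z X :
  derivable (F \o cline z X) 0 1 -> is_dmap F z X (dmap F z X).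
Proof. by split=> //; rewrite /dmap derive1E. Qed.

Lemma is_dmap_near (W : normedModType R) V (F G : C -> W) z X dF :
  open V -> V z -> (forall y, V y -> F y = G y) ->
  is_dmap F z X dF -> is_dmap G z X dF.
Proof.
move=> oV Vz FG; apply: near_eq_is_derive.
by near=> t; apply: FG; near: t; exact: near_cline.
Unshelve. all: by end_near. Qed.

Lemma is_dmapD (W : normedModType R) (F G : C -> W) z X dF dG :
  is_dmap F z X dF -> is_dmap G z X dG ->
  is_dmap (fun y => F y + G y) z X (dF + dG).
Proof. exact: is_deriveD. Qed.

Lemma is_dmapZ (W : normedModType R) k (F : C -> W) z X dF :
  is_dmap F z X dF -> is_dmap (fun y => k *: F y) z X (k *: dF).
Proof. exact: is_deriveZ. Qed.

Lemma is_dmap_scale (W : normedModType R) (a : C -> R^o) (F : C -> W) z X da dF :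
  is_dmap a z X da -> is_dmap F z X dF ->
  is_dmap (fun y => a y *: F y) z X (a z *: dF + da *: F z).
Proof.
by move=> da_ dF_; have := is_derive_scale da_ dF_; rewrite /= cline0.
Qed.

Lemma is_dmap_dot n (F G : C -> 'rV[R]_n) z X dF dG :
  is_dmap F z X dF -> is_dmap G z X dG ->
  is_dmap (fun y => dot (F y) (G y) : R^o) z X (dot (F z) dG + dot dF (G z)).
Proof.
by move=> dF_ dG_; have := is_derive_dot dF_ dG_; rewrite /= cline0.
Qed.

Lemma is_dmapV (a : C -> R^o) z X da : a z != 0 ->
  is_dmap a z X da ->
  is_dmap (fun y => (a y)^-1 : R^o) z X (- (a z)^-1 ^+ 2 * da).
Proof.
move=> az da_; have := @is_deriveV R (a \o cline z X) 0 da 1.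
by rewrite /= cline0 exprVn; apply.
Qed.

(** * Closure of the class C^k on an open set under algebraic operations *)

Section Closure.
Variable V : set C.
Hypothesis oV : open V.

Lemma Ck_continuous (W : normedModType R) k (F : C -> W) :
  Ck k V F -> {in V, continuous F}.
Proof. by case: k => [|k] []. Qed.

Lemma CkS_is_dmap (W : normedModType R) k (F : C -> W) z X :
  Ck k.+1 V F -> V z -> is_dmap F z X (dmap F z X).
Proof. by move=> [_ /(_ X)[dF _]] Vz; apply/is_dmapP/dF. Qed.

Lemma CkS_dmap (W : normedModType R) k (F : C -> W) X :
  Ck k.+1 V F -> Ck k V (dmap F ^~ X).
Proof. by move=> [_ /(_ X)[]]. Qed.

Lemma CkW (W : normedModType R) k (F : C -> W) : Ck k.+1 V F -> Ck k V F.
Proof.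
elim: k F => [|k IH] F; first by case.
by move=> [cF dF]; split=> // X; have [? /IH] := dF X.
Qed.

(** Agreement on the open set [V] is agreement near each of its points, so it passes to limits and
    to all derivatives. *)
Lemma eq_Ck (W : normedModType R) k (F G : C -> W) :
  (forall z, V z -> F z = G z) -> Ck k V F -> Ck k V G.
Proof.
have cont (F' G' : C -> W) : (forall z, V z -> F' z = G' z) ->
    {in V, continuous F'} -> {in V, continuous G'}.
  move=> FG cF z zV; have Vz := set_mem zV.
  have nFG : \forall y \near z, F' y = G' y.
    by apply: (filterS FG); apply: open_nbhs_nbhs.
  rewrite /continuous_at -FG //; apply: cvg_trans (cF z zV).
  exact: near_eq_cvg nFG.
elim: k F G => [|k IH] F G FG CF.
  by split=> //; apply: cont FG _; case: CF.
split; first by apply: cont FG _; case: CF.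
move=> X; split=> [z Vz|].
  by have [] := is_dmap_near oV Vz FG (CkS_is_dmap X CF Vz).
apply: IH (CkS_dmap X CF) => z Vz; apply/esym/dmapE.
exact: is_dmap_near oV Vz FG (CkS_is_dmap X CF Vz).
Qed.

(** Lets an explicit formula [dF] replace [dmap F] in inductions on the order; by [eq_Ck] the two
    need to agree on [V] only. *)
Lemma CkS_intro (W : normedModType R) k (F : C -> W) (dF : C -> C -> W) :
  {in V, continuous F} -> (forall z X, V z -> is_dmap F z X (dF z X)) ->
  (forall X, Ck k V (dF ^~ X)) -> Ck k.+1 V F.
Proof.
move=> cF dFP CdF; split=> // X; split=> [z Vz|]; first by have [] := dFP z X Vz.
by apply: eq_Ck (CdF X) => z Vz; apply/esym/dmapE/dFP.
Qed.

Lemma CkD (W : normedModType R) k (F G : C -> W) :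
  Ck k V F -> Ck k V G -> Ck k V (fun z => F z + G z).
Proof.
elim: k F G => [|k IH] F G CF CG;
  have cF := Ck_continuous CF; have cG := Ck_continuous CG.
  by split=> // z zV; exact: cvgD (cF z zV) (cG z zV).
apply: (@CkS_intro _ _ _ (fun z X => dmap F z X + dmap G z X)).
- by move=> z zV; exact: cvgD (cF z zV) (cG z zV).
- by move=> z X Vz; exact: is_dmapD (CkS_is_dmap X CF Vz) (CkS_is_dmap X CG Vz).
- by move=> X; exact: IH (CkS_dmap X CF) (CkS_dmap X CG).
Qed.

Lemma CkZ (W : normedModType R) k (a : C -> R^o) (F : C -> W) :
  Ck k V a -> Ck k V F -> Ck k V (fun z => a z *: F z).
Proof.
elim: k a F => [|k IH] a F Ca CF;
  have ca := Ck_continuous Ca; have cF := Ck_continuous CF.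
  by split=> // z zV; exact: cvgZ (ca z zV) (cF z zV).
apply: (@CkS_intro _ _ _ (fun z X => a z *: dmap F z X + dmap a z X *: F z)).
- by move=> z zV; exact: cvgZ (ca z zV) (cF z zV).
- by move=> z X Vz; exact: is_dmap_scale (CkS_is_dmap X Ca Vz) (CkS_is_dmap X CF Vz).
- move=> X.
  (* Each term of the product rule keeps one undifferentiated factor, which [CkW] lowers to order
     [k]. *)
  exact: CkD (IH _ _ (CkW Ca) (CkS_dmap X CF)) (IH _ _ (CkS_dmap X Ca) (CkW CF)).
Qed.

Lemma Ck_cst (W : normedModType R) k (w : W) : Ck k V (fun=> w).
Proof.
elim: k w => [|k IH] w; first by split=> // z _; exact: cst_continuous.
apply: (@CkS_intro _ _ _ (fun _ _ => 0 : W)) => [z _|z X Vz|X].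
- exact: cst_continuous.
- exact: is_derive_cst.
- exact: IH.
Qed.

Lemma Ck_coord m n k (F : C -> 'M[R]_(m, n)) i j :
  Ck k V F -> Ck k V (fun z => F z i j : R^o).
Proof.
have cont : Ck 0 V F -> {in V, continuous (fun z => F z i j : R^o)}.
  move=> [cF _] z zV.
  exact: continuous_comp (cF z zV) (@coord_continuous _ _ _ i j (F z)).
elim: k F cont => [|k IH] F cont CF; first by split=> //; exact: cont.
apply: (@CkS_intro _ _ _ (fun z X => dmap F z X i j)).
- by apply: cont; case: CF.
- by move=> z X Vz; exact: is_derive_coord (CkS_is_dmap X CF Vz).
- move=> X; apply: IH (CkS_dmap X CF) => -[cF _] z zV.
  exact: continuous_comp (cF z zV) (@coord_continuous _ _ _ i j (dmap F z X)).
Qed.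

Lemma Ck_sum (W : normedModType R) (I : finType) k (F : I -> C -> W) :
  (forall i, Ck k V (F i)) -> Ck k V (fun z => \sum_i F i z).
Proof.
move=> CF; elim: (index_enum I) => [|i s IH].
  by apply: eq_Ck (Ck_cst k (0 : W)) => z _; rewrite big_nil.
by apply: eq_Ck (CkD (CF i) IH) => z _; rewrite big_cons.
Qed.

Lemma Ck_dot n k (F G : C -> 'rV[R]_n) :
  Ck k V F -> Ck k V G -> Ck k V (fun z => dot (F z) (G z) : R^o).
Proof. by move=> CF CG; apply: Ck_sum => i; apply: CkZ; apply: Ck_coord. Qed.

Lemma CkV k (a : C -> R^o) : (forall z, V z -> a z != 0) ->
  Ck k V a -> Ck k V (fun z => (a z)^-1 : R^o).
Proof.
move=> a0; have cont : Ck 0 V a -> {in V, continuous (fun z => (a z)^-1 : R^o)}.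
  by move=> [ca _] z zV; exact: cvgV (a0 z (set_mem zV)) (ca z zV).
elim: k => [|k IH] Ca; first by split=> //; exact: cont.
apply: (@CkS_intro _ _ _ (fun z X => - (a z)^-1 ^+ 2 * dmap a z X)).
- by apply: cont; case: Ca.
- by move=> z X Vz; apply: is_dmapV; [exact: a0 | exact: CkS_is_dmap Ca Vz].
(* The derivative of [1 / a] involves [1 / a] only undifferentiated, where the induction hypothesis
   applies. *)
- move=> X; have CV := IH (CkW Ca).
  apply: eq_Ck (CkZ (CkZ (Ck_cst k (-1 : R^o)) (CkZ CV CV))
    (CkS_dmap X Ca)) => z _.
  by rewrite scaleN1r expr2.
Qed.

Lemma Ck_vec_inv n k (F : C -> 'rV[R]_n) : (forall z, V z -> F z != 0) ->
  Ck k V F -> Ck k V (fun z => vec_inv (F z)).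
Proof.
move=> F0 CF; apply: CkZ => //.
apply: eq_Ck (CkZ (Ck_cst k (-1 : R^o)) (CkV _ (Ck_dot CF CF))).
  by move=> z _; rewrite scaleN1r.
by move=> z Vz; rewrite dot_eq0 F0.
Qed.

End Closure.
End LinesAndCk.

(** * Bilinearity of the dot product *)

Section DotProduct.
Variables (K : comPzRingType) (n : nat).
Implicit Types u v w : 'rV[K]_n.

Lemma dotC u v : dot u v = dot v u.
Proof. by apply: eq_bigr => i _; rewrite mulrC. Qed.

Lemma dotDl u v w : dot (u + v) w = dot u w + dot v w.
Proof. by rewrite -big_split; apply: eq_bigr => i _; rewrite mxE mulrDl. Qed.

Lemma dotZl k u v : dot (k *: u) v = k * dot u v.
Proof. by rewrite mulr_sumr; apply: eq_bigr => i _; rewrite mxE mulrA. Qed.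

Lemma dotDr u v w : dot u (v + w) = dot u v + dot u w.
Proof. by rewrite dotC dotDl !(dotC u). Qed.

Lemma dotZr k u v : dot u (k *: v) = k * dot u v.
Proof. by rewrite dotC dotZl dotC. Qed.

Lemma dotNl u v : dot (- u) v = - dot u v.
Proof. by rewrite -scaleN1r dotZl mulN1r. Qed.

Lemma dotNr u v : dot u (- v) = - dot u v.
Proof. by rewrite dotC dotNl dotC. Qed.

Lemma dot0l u : dot 0 u = 0.
Proof. by rewrite -(scale0r 0) dotZl mul0r. Qed.

Definition dotE := (dotDl, dotDr, dotNl, dotNr, dotZl, dotZr).

End DotProduct.

Lemma dot_map (K L : pzRingType) (phi : {rmorphism K -> L}) n (u v : 'rV[K]_n) :
  dot (map_mx phi u) (map_mx phi v) = phi (dot u v).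
Proof. by rewrite rmorph_sum; apply: eq_bigr => i _; rewrite !mxE rmorphM. Qed.

(** * Vectors in the Clifford algebra: inversion and sandwiching *)

Section Reflections.
Variables (R : realType) (n : nat).
Implicit Types u v w : 'rV[R]_n.

Lemma dot_gt0 u : u != 0 -> 0 < dot u u.
Proof.
rewrite -dot_eq0 lt0r => -> /=.
by apply: sumr_ge0 => i _; rewrite -expr2 sqr_ge0.
Qed.

(** Coordinate [i] of a vector is its coefficient on the singleton [{i}]. Injectivity allows
    identities between vectors to be proved in the Clifford algebra. *)
Lemma cl_vec_inj : injective (@cl_vec R n).
Proof.
have coord v i : cl_vec v [set i]%SET = v 0 i.
  rewrite /cl_vec sum_ffunE (bigD1 i) //= big1 => [|j ji].
    by rewrite addr0 !ffunE eqxx /GRing.scale/= mulr1.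
  rewrite !ffunE (inj_eq finset.set1_inj) eq_sym (negPf ji).
  by rewrite /GRing.scale/= mulr0.
by move=> u v uv; apply/rowP => i; rewrite -!coord uv.
Qed.

Lemma cl_vecN u : cl_vec (- u) = - cl_vec u.
Proof. by rewrite -scaleN1r cl_vecZ scaleN1r. Qed.

Lemma cl_vecB u v : cl_vec (u - v) = cl_vec u - cl_vec v.
Proof. by rewrite cl_vecD cl_vecN. Qed.

Lemma cl_vec_unit u : u != 0 -> cl_vec u \is a GRing.unit.
Proof.
rewrite -dot_eq0 => u0; apply/unitrP; exists (cl_vec (vec_inv u)).
rewrite cl_vecZ -scalerAl -scalerAr cl_vec_sqr scalerA mulrNN mulVf //.
by rewrite scale1r.
Qed.

Lemma vec_inv_neq0 u : u != 0 -> vec_inv u != 0.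
Proof.
by move=> u0; rewrite scaler_eq0 oppr_eq0 invr_eq0 dot_eq0 (negPf u0).
Qed.

Lemma vec_invZ k u : vec_inv (k *: u) = k^-1 *: vec_inv u.
Proof.
(* For [k = 0] both sides vanish, since the inverse of zero is zero by convention. *)
have [->|k0] := eqVneq k 0; first by rewrite invr0 !scale0r /vec_inv scaler0.
rewrite /vec_inv dotZl dotZr !invfM !scalerA; congr (_ *: _).
by rewrite mulNr mulrN -[k^-1 in RHS]mulr1 -[in RHS](mulVf k0); ring.
Qed.

(** The sandwich [u v u] as a vector: [dot u u] times the reflection of [v] in the hyperplane
    orthogonal to [u], when [u] is nonzero. *)
Definition refl u v : 'rV[R]_n := dot u u *: v - (2 * dot u v) *: u.

Lemma cl_refl u v : cl_vec (refl u v) = cl_vec u * cl_vec v * cl_vec u.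
Proof.
have -> : cl_vec u * cl_vec v =
    (- 2 * dot u v) *: 1 - cl_vec v * cl_vec u.
  by rewrite -cl_vec_anticomm addrK.
rewrite mulrBl -scalerAl mul1r -mulrA cl_vec_sqr -scalerAr mulr1.
by rewrite cl_vecB !cl_vecZ scaleNr opprK mulNr scaleNr addrC.
Qed.

Lemma reflZl k u v : refl (k *: u) v = k ^+ 2 *: refl u v.
Proof.
apply/rowP => i; rewrite /refl !dotE !mxE; ring.
Qed.

Lemma reflZr k u v : refl u (k *: v) = k *: refl u v.
Proof. apply/rowP => i; rewrite /refl !dotE !mxE; ring. Qed.

Lemma reflB u v w : refl u (v - w) = refl u v - refl u w.
Proof. apply/rowP => i; rewrite /refl !dotE !mxE; ring. Qed.

Lemma dot_refl u v w : dot (refl u v) (refl u w) = dot u u ^+ 2 * dot v w.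
Proof. by rewrite /refl !dotE (dotC v u); ring. Qed.

Lemma refl_vec_inv u v : refl (vec_inv u) v = (dot u u)^-1 ^+ 2 *: refl u v.
Proof. by rewrite /vec_inv reflZl sqrrN. Qed.

(** Sandwiching by the inverse of [u] is sandwiching by [u] divided by [dot u u ^+ 2], exactly the
    factor produced by [dot_refl]. *)
Lemma dot_refl_vec_inv u v w : u != 0 ->
  dot (refl u v) (refl (vec_inv u) w) = dot v w.
Proof.
rewrite -dot_eq0 => u0; rewrite refl_vec_inv dotZr dot_refl mulrA.
by rewrite -exprMn mulVf // expr1n mul1r.
Qed.

Lemma reflK u v : u != 0 -> refl (vec_inv u) (refl u v) = v.
Proof.
move=> u0; have uU := cl_vec_unit u0.
apply: cl_vec_inj; rewrite !cl_refl -cl_vec_inv // !mulrA (mulVr uU) mul1r.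
by rewrite -mulrA (divrr uU) mulr1.
Qed.

Lemma vec_invK u : vec_inv (vec_inv u) = u.
Proof.
have [->|u0] := eqVneq u 0; first by rewrite /vec_inv !scaler0.
apply: cl_vec_inj.
by rewrite -cl_vec_inv ?vec_inv_neq0 // -cl_vec_inv // invrK.
Qed.

Lemma vec_inv_inj : injective (@vec_inv R n).
Proof. exact: can_inj vec_invK. Qed.

End Reflections.

(** * Noncommutative identities behind the fourth point *)

Section FourthPoint.
Variables (R : realType) (n : nat) (r1 r2 : R) (a b w gh : clifford R n).
Hypothesis r1_neq0 : r1 != 0.
Hypothesis wE : w = r2 *: a - r1 *: b.
Hypotheses (aU : a \is a GRing.unit) (wU : w \is a GRing.unit).
Hypothesis ghE : gh = (r2 - r1) *: w^-1 - a^-1.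

(** Multiplying by [w] on the left turns [gh * a] into [(r2 - r1) a - w], which is [r1 (b - a)]. *)
Lemma fourth_mull : gh * a = r1 *: (w^-1 * (b - a)).
Proof.
apply: (mulrI wU); rewrite ghE mulrBl (mulVr aU) mulrBr mulr1 -scalerAl -scalerAr.
rewrite (mulVKr wU) -scalerAr (mulVKr wU) wE.
by apply/ffunP => C; rewrite !ffunE /GRing.scale/=; ring.
Qed.

Lemma fourth_mulr : a * gh = r1 *: ((b - a) * w^-1).
Proof.
apply: (mulIr wU); rewrite ghE mulrBr (divrr aU) mulrBl mul1r -scalerAr -scalerAl.
rewrite (mulrVK wU) -scalerAl (mulrVK wU) wE.
by apply/ffunP => C; rewrite !ffunE /GRing.scale/=; ring.
Qed.

Lemma fourth_sandwich d :
  (r2 / r1) *: (gh * (a * d * a) * gh) =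
  d - (r2 - r1) *: (w^-1 * (r2 *: (a * d * a) - r1 *: (b * d * b)) * w^-1).
Proof.
have -> : gh * (a * d * a) * gh = (gh * a) * d * (a * gh) by rewrite !mulrA.
rewrite fourth_mull fourth_mulr.
have -> : r1 *: (w^-1 * (b - a)) * d * (r1 *: ((b - a) * w^-1)) =
    r1 ^+ 2 *: (w^-1 * ((b - a) * d * (b - a)) * w^-1).
  by rewrite -!scalerAl -scalerAr scalerA -expr2 !mulrA.
have sandwichK x : w * (w^-1 * x * w^-1) * w = x.
  by rewrite !mulrA (divrr wU) mul1r (mulrVK wU).
(* Multiplying by [w] on both sides clears the inverses; both sides then equal
   [r1 r2 (b - a) d (b - a)]. *)
apply: (mulrI wU); apply: (mulIr wU).
rewrite /= [in RHS](mulrBr w) (mulrBl w) -!scalerAr -!scalerAl !sandwichK.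
rewrite wE !mulrBl !mulrBr -!scalerAl -!scalerAr.
move: (a * d * a) (a * d * b) (b * d * a) (b * d * b) => A B C D.
by apply/ffunP => E; rewrite !ffunE /GRing.scale/=; field.
Qed.

End FourthPoint.

(** * The fourth point as a vector *)

Section FourthVector.
Variables (R : realType) (n : nat) (r1 r2 : R) (g1 g2 : 'rV[R]_n).
Hypotheses (r1_neq0 : r1 != 0) (g1_neq0 : g1 != 0) (g2_neq0 : g2 != 0).
Let a := vec_inv g1.
Let b := vec_inv g2.

Definition fourth_denom : 'rV[R]_n := r2 *: vec_inv g1 - r1 *: vec_inv g2.

(** The displacement from [f] to the fourth point, whereas [gh] below is the displacement from [f1].
    It vanishes for [r1 = r2]: the fourth surface is then [f]. *)
Definition fourth_vec : 'rV[R]_n := (r2 - r1) *: vec_inv fourth_denom.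

Hypothesis w_neq0 : fourth_denom != 0.
Let w := fourth_denom.
Let gh := fourth_vec - g1.

Let cl_wE : cl_vec w = r2 *: cl_vec a - r1 *: cl_vec b.
Proof. by rewrite cl_vecB (cl_vecZ r2) (cl_vecZ r1). Qed.

Let cl_ghE : cl_vec gh = (r2 - r1) *: (cl_vec w)^-1 - (cl_vec a)^-1.
Proof.
rewrite cl_vecB (cl_vecZ (r2 - r1)) -[cl_vec (vec_inv _)]cl_vec_inv //.
congr (_ - _).
by rewrite -cl_vec_inv // invrK.
Qed.

Let aU : cl_vec a \is a GRing.unit.
Proof. exact/cl_vec_unit/vec_inv_neq0. Qed.

(** Carries [fourth_sandwich] over to vectors. For [d = df] the argument of the last sandwich is
    [dw], so the right-hand side is the differential of the fourth surface. *)
Lemma refl_fourth d : (r2 / r1) *: refl gh (refl a d) =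
  d - (r2 - r1) *: refl (vec_inv w) (r2 *: refl a d - r1 *: refl b d).
Proof.
apply: cl_vec_inj; rewrite (cl_vecB d) (cl_vecZ (r2 / r1)) (cl_vecZ (r2 - r1)).
rewrite (cl_refl gh) (cl_refl (vec_inv w)) (cl_vecB (r2 *: _)) (cl_vecZ r2).
rewrite (cl_vecZ r1) (cl_refl a) (cl_refl b) -[cl_vec (vec_inv w)]cl_vec_inv //.
exact: fourth_sandwich r1_neq0 cl_wE aU (cl_vec_unit w_neq0) cl_ghE _.
Qed.

Lemma fourth_vec_mul :
  cl_vec gh * cl_vec a = r1 *: ((cl_vec w)^-1 * (cl_vec b - cl_vec a)).
Proof. exact: fourth_mull cl_wE aU (cl_vec_unit w_neq0) cl_ghE. Qed.

(** If [gh] vanished, [fourth_vec_mul] would force [a = b], and inversion of vectors is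
    injective. *)
Lemma fourth_vec_neq : g1 != g2 -> fourth_vec != g1.
Proof.
move=> g12; rewrite -subr_eq0; apply: contraNneq g12 => gh0.
have := fourth_vec_mul; rewrite /gh gh0.
have -> : cl_vec (0 : 'rV[R]_n) = 0 by rewrite -(scale0r 0) cl_vecZ scale0r.
rewrite mul0r => /esym/eqP; rewrite scaler_eq0 (negPf r1_neq0) /=.
move=> /eqP/(congr1 ( *%R (cl_vec w))); rewrite mulr0.
rewrite (mulVKr (cl_vec_unit w_neq0)) => /eqP; rewrite subr_eq0 => /eqP ba.
by apply/eqP/vec_inv_inj/cl_vec_inj; rewrite -/a -/b ba.
Qed.

End FourthVector.

Lemma fourth_denomC (R : realType) n (r1 r2 : R) (g1 g2 : 'rV[R]_n) :
  fourth_denom r2 r1 g2 g1 = - fourth_denom r1 r2 g1 g2.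
Proof. by rewrite opprB. Qed.

(** Both [r2 - r1] and the denominator change sign under the exchange of the two transforms. *)
Lemma fourth_vecC (R : realType) n (r1 r2 : R) (g1 g2 : 'rV[R]_n) :
  fourth_vec r2 r1 g2 g1 = fourth_vec r1 r2 g1 g2.
Proof.
rewrite /fourth_vec fourth_denomC -(scaleN1r (fourth_denom _ _ _ _)) vec_invZ.
rewrite invrN1 scalerA.
by rewrite mulrN1 opprB.
Qed.

(** The inner factors of the product cancel: [(u g^-1 p g^-1 u) (u^-1 g q g u^-1) = u g^-1 (p q) g
    u^-1], which is linear in [p q]. *)
Lemma sandwich_wedge (R : realType) n (k l : R) (u g p q p' q' : 'rV[R]_n) :
  u != 0 -> g != 0 ->
  cl_vec p * cl_vec q - cl_vec p' * cl_vec q' = 0 ->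
  cl_vec (k *: refl u (refl (vec_inv g) p)) *
    cl_vec (l *: refl (vec_inv u) (refl g q)) -
  cl_vec (k *: refl u (refl (vec_inv g) p')) *
    cl_vec (l *: refl (vec_inv u) (refl g q')) = 0.
Proof.
move=> u0 g0 pq.
have mulE x y : cl_vec (k *: refl u (refl (vec_inv g) x)) *
      cl_vec (l *: refl (vec_inv u) (refl g y)) =
    (k * l) *: (cl_vec u * (cl_vec g)^-1 * (cl_vec x * cl_vec y) *
                (cl_vec g * (cl_vec u)^-1)).
  rewrite !cl_vecZ !cl_refl -!cl_vec_inv // -scalerAl -scalerAr scalerA.
  by rewrite !mulrA (mulrK (cl_vec_unit u0)) (mulrVK (cl_vec_unit g0)).
by rewrite !mulE -scalerBr -mulrBl -mulrBr pq mulr0 mul0r scaler0.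
Qed.

(** * Differentials of maps on a Riemann surface *)

Section Bianchi.
Variables (R : realType) (n : nat) (M : riemannSurface R).
Local Notation C := (R[i]^o).
Implicit Types (f g fc : M -> 'rV[R]_n) (c : chart R M) (z X Y : C).

(** This is the Clifford rule [d(F^-1) = - F^-1 dF F^-1], obtained from the scalar quotient rule
    applied to [- F / (F, F)]. *)
Lemma is_dmap_vec_inv (F : C -> 'rV[R]_n) z X dF : F z != 0 ->
  is_dmap F z X dF ->
  is_dmap (fun y => vec_inv (F y)) z X (- refl (vec_inv (F z)) dF).
Proof.
move=> Fz0 dF_; have N0 : dot (F z) (F z) != 0 by rewrite dot_eq0.
have dN := is_dmapZ (-1) (is_dmapV N0 (is_dmap_dot dF_ dF_)).
have := is_dmap_scale dN dF_.
have -> : (fun y => (-1 *: ((dot (F y) (F y))^-1 : R^o)) *: F y) =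
    (fun y => vec_inv (F y)) by apply/funext => y; rewrite scaleN1r.
congr is_dmap; rewrite refl_vec_inv; apply/rowP => i; rewrite !mxE.
by rewrite (dotC dF) /GRing.scale/=; field.
Qed.

Lemma smooth_is_dmap f c z X : smooth_map f -> atlas c -> chart_img c z ->
  is_dmap (f \o chart_inv c) z X (dform f c z X).
Proof. by move=> fS ca cz; apply: (@CkS_is_dmap _ _ _ 0) cz; exact: fS. Qed.

Lemma smooth_mapD f g :
  smooth_map f -> smooth_map g -> smooth_map (fun p => f p + g p).
Proof.
move=> fS gS c ca k.
have := CkD (@chart_img_open _ _ c) (fS c ca k) (gS c ca k); exact.
Qed.

Lemma smooth_mapZ a f : smooth_map f -> smooth_map (fun p => a *: f p).
Proof.
move=> fS c ca k; have oV := @chart_img_open _ _ c.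
have := CkZ oV (Ck_cst oV k (a : R^o)) (fS c ca k); exact.
Qed.

Lemma smooth_map_vec_inv f : (forall p, f p != 0) ->
  smooth_map f -> smooth_map (fun p => vec_inv (f p)).
Proof.
move=> f0 fS c ca k.
have f0' z : chart_img c z -> (f \o chart_inv c) z != 0 by move=> _; exact: f0.
have := Ck_vec_inv (@chart_img_open _ _ c) f0' (fS c ca k); exact.
Qed.

Lemma smooth_mapB f g :
  smooth_map f -> smooth_map g -> smooth_map (fun p => f p - g p).
Proof.
move=> fS gS; have -> : (fun p => f p - g p) = (fun p => f p + (-1) *: g p).
  by apply/funext => p; rewrite scaleN1r.
by apply: smooth_mapD => //; exact: smooth_mapZ.
Qed.

(** * Differentials of a Darboux transform and of its Christoffel transform *)

Section Darboux.
Variables (r : R) (f fc fh : M -> 'rV[R]_n).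
Hypotheses (fS : smooth_map f) (fcS : smooth_map fc).
Hypothesis fh_darboux : is_darboux r f fc fh.

Lemma darboux_diff_smooth : smooth_map (fun p => fh p - f p).
Proof.
have [g [gS _ fhE]] := fh_darboux.
by have -> : (fun p => fh p - f p) = g by apply/funext => p; rewrite fhE addrC addKr.
Qed.

(** The Riccati equation read on vectors, with the existentially quantified [g] replaced by
    [fh - f]. *)
Lemma darboux_diff_dmap c z X : atlas c -> chart_img c z ->
  is_dmap (fun y => fh (chart_inv c y) - f (chart_inv c y)) z X
    (r *: refl (fh (chart_inv c z) - f (chart_inv c z)) (dform fc c z X) -
     dform f c z X).
Proof.
move=> ca cz; have [g [gS gR fhE]] := fh_darboux.
have gE p : fh p - f p = g p by rewrite fhE addrC addKr.
have -> : (fun y => fh (chart_inv c y) - f (chart_inv c y)) = g \o chart_inv c.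
  by apply/funext => y; exact: gE.
rewrite gE; have := smooth_is_dmap X gS ca cz; congr is_dmap.
by apply: cl_vec_inj; rewrite cl_vecB cl_vecZ cl_refl; exact: gR.
Qed.

Lemma darboux_smooth : smooth_map fh.
Proof.
have -> : fh = (fun p => f p + (fh p - f p)).
  by apply/funext => p; rewrite subrKC.
exact: smooth_mapD fS darboux_diff_smooth.
Qed.

(** Adding [df] to the Riccati equation cancels its last term, leaving [r g df^c g]. *)
Lemma darboux_dform c z X : atlas c -> chart_img c z ->
  dform fh c z X =
  r *: refl (fh (chart_inv c z) - f (chart_inv c z)) (dform fc c z X).
Proof.
move=> ca cz.
have := is_dmapD (smooth_is_dmap X fS ca cz) (darboux_diff_dmap X ca cz).
have -> : (fun y => (f \o chart_inv c) y +
    (fh (chart_inv c y) - f (chart_inv c y))) = fh \o chart_inv c.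
  by apply/funext => y /=; rewrite subrKC.
by move=> /dmapE; rewrite subrKC.
Qed.

Hypotheses (r_neq0 : r != 0) (fh_neq_f : forall p, fh p - f p != 0).

Lemma christoffel_smooth : smooth_map (darboux_christoffel r f fc fh).
Proof.
apply: smooth_mapD fcS _; apply: smooth_map_vec_inv.
  by move=> p; rewrite scaler_eq0 negb_or r_neq0 fh_neq_f.
exact: smooth_mapZ darboux_diff_smooth.
Qed.

(** Inverting [r g] sends the Riccati equation to [d((r g)^-1) = - df^c + r^-1 g^-1 df g^-1], so
    [df^c] cancels. Thus the transform exchanges the roles of [df] and [df^c]. *)
Lemma christoffel_dform c z X : atlas c -> chart_img c z ->
  dform (darboux_christoffel r f fc fh) c z X =
  r^-1 *: refl (vec_inv (fh (chart_inv c z) - f (chart_inv c z))) (dform f c z X).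
Proof.
move=> ca cz; set G := fh _ - f _.
have dg := is_dmapZ r (darboux_diff_dmap X ca cz).
have rg0 : r *: G != 0 by rewrite scaler_eq0 negb_or r_neq0 fh_neq_f.
have := is_dmapD (smooth_is_dmap X fcS ca cz) (is_dmap_vec_inv rg0 dg).
move=> /dmapE dE; etransitivity; first exact: dE.
rewrite vec_invZ reflZl reflZr reflB reflZr reflK ?fh_neq_f //.
rewrite -/G; move: (refl (vec_inv G) (dform f c z X)) => v.
by apply/rowP => i; rewrite !mxE; field.
Qed.

End Darboux.

(** The (2,0)-part is a complex combination of the real products of the differentials on the tangent
    vectors [1] and [i]. *)
Lemma eq_dot_dform_dz f fc g gc c z :
  (forall X Y, dot (dform g c z X) (dform gc c z Y) =
               dot (dform f c z X) (dform fc c z Y)) ->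
  dot (dform_dz g c z) (dform_dz gc c z) = dot (dform_dz f c z) (dform_dz fc c z).
Proof.
have dzE (k i : R[i]) (u u' v v' s s' t t' : 'rV[R[i]]_n) :
    dot u v = dot s t -> dot u v' = dot s t' ->
    dot u' v = dot s' t -> dot u' v' = dot s' t' ->
    dot (k *: (u - i *: u')) (k *: (v - i *: v')) =
    dot (k *: (s - i *: s')) (k *: (t - i *: t')).
  by move=> e1 e2 e3 e4; rewrite !dotE e1 e2 e3 e4.
move=> gf.
have mapE X Y : dot (map_mx (real_complex R) (dform g c z X))
      (map_mx (real_complex R) (dform gc c z Y)) =
    dot (map_mx (real_complex R) (dform f c z X))
      (map_mx (real_complex R) (dform fc c z Y)).
  have fE := dot_map (real_complex R) (dform f c z X) (dform fc c z Y).
  apply/esym; etransitivity; first exact: fE.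
  by rewrite -gf; apply/esym; exact: dot_map.
by apply: dzE; exact: mapE.
Qed.

(* D_r f itself need not be isothermic here: its differential vanishes with df^c.
   The second transform exchanges df and df^c once more, so its differential is a
   double sandwich of df, and that of its Christoffel transform one of df^c. *)
Lemma darboux_twice_isothermic Q (r r' : R) f fc f1 fh :
  r != 0 -> r' != 0 -> isothermic Q f -> is_christoffel Q f fc ->
  is_darboux r f fc f1 -> (forall p, f1 p - f p != 0) ->
  is_darboux r' f1 (darboux_christoffel r f fc f1) fh ->
  (forall p, fh p - f1 p != 0) ->
  isothermic Q fh.
Proof.
move=> r0 r'0 [[fS f_conf] _] [fcS fcW fcQ] f1D f1f fhD fhf1.
have f1S := darboux_smooth fS f1D.
set fc1 := darboux_christoffel r f fc f1 in fhD.
have fc1S : smooth_map fc1 := christoffel_smooth fcS f1D r0 f1f.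
set fch := darboux_christoffel r' f1 fc1 fh.
have fchS : smooth_map fch := christoffel_smooth fc1S fhD r'0 fhf1.
pose g c z := f1 (chart_inv c z) - f (chart_inv c z).
pose gh c z := fh (chart_inv c z) - f1 (chart_inv c z).
have dfh c z X : atlas c -> chart_img c z -> dform fh c z X =
    (r' / r) *: refl (gh c z) (refl (vec_inv (g c z)) (dform f c z X)).
  move=> ca cz; rewrite (darboux_dform f1S fhD) // /fc1.
  by rewrite (christoffel_dform fcS f1D) // reflZr scalerA.
have dfch c z X : atlas c -> chart_img c z -> dform fch c z X =
    (r'^-1 * r) *: refl (vec_inv (gh c z)) (refl (g c z) (dform fc c z X)).
  move=> ca cz; rewrite (christoffel_dform fc1S fhD) //.
  by rewrite (darboux_dform fS f1D) // reflZr scalerA.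
clearbody fch fc1; split.
  split=> [|c z ca cz]; first exact: darboux_smooth f1S fhD.
  have [l l0 fl] := f_conf c z ca cz.
  (* Each of the two sandwiches contributes the factor of [dot_refl], and the constant its square;
     none of them vanishes. *)
  exists ((r' / r) ^+ 2 * dot (gh c z) (gh c z) ^+ 2 *
          dot (vec_inv (g c z)) (vec_inv (g c z)) ^+ 2 * l).
    have k0 : 0 < (r' / r) ^+ 2.
      by rewrite exprn_even_gt0 //= mulf_neq0 ?invr_eq0.
    have sq_gt0 (u : 'rV[R]_n) : u != 0 -> 0 < dot u u ^+ 2 :> R.
      by move=> u0; rewrite exprn_gt0 ?dot_gt0.
    have gh_gt0 := sq_gt0 (gh c z) (fhf1 _).
    have a_gt0 := sq_gt0 _ (vec_inv_neq0 (f1f (chart_inv c z))).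
    exact: mulr_gt0 (mulr_gt0 (mulr_gt0 k0 gh_gt0) a_gt0) l0.
  by move=> X Y; rewrite !dfh // dotZl dotZr !dot_refl fl; ring.
exists fch; split; [exact: fchS | move=> c z ca cz X Y | move=> c z ca cz].
  rewrite /cl_wedge /cl_dform !(dfh _ _ _ ca cz) !(dfch _ _ _ ca cz).
  exact: sandwich_wedge (fhf1 _) (f1f _) (fcW c z ca cz X Y).
rewrite -(fcQ _ _ ca cz); apply: eq_dot_dform_dz => X Y.
rewrite (dfh _ _ _ ca cz) (dfch _ _ _ ca cz) dotZl dotZr.
(* Writing [g] as the inverse of [g^-1] makes the inner pair of sandwiches cancel like the outer
   one. *)
rewrite dot_refl_vec_inv ?fhf1 // -{2}(vec_invK (g c z)) dot_refl_vec_inv.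
  by move: (dot _ _) => t; field; rewrite r0 r'0.
exact/vec_inv_neq0/f1f.
Qed.

(** * The Riccati equation of the fourth surface *)

Section FourthSurface.
Variables (f fc : M -> 'rV[R]_n) (r1 r2 : R) (f1 f2 : M -> 'rV[R]_n).
Hypotheses (fS : smooth_map f) (fcS : smooth_map fc).
Hypotheses (r1_neq0 : r1 != 0) (r2_neq0 : r2 != 0).
Hypotheses (f1D : is_darboux r1 f fc f1) (f2D : is_darboux r2 f fc f2).
Hypotheses (f1f : forall p, f1 p - f p != 0) (f2f : forall p, f2 p - f p != 0).
Hypothesis w_neq0 :
  forall p, fourth_denom r1 r2 (f1 p - f p) (f2 p - f p) != 0.

(** The goal is [d gh = r2 gh df1^c gh - df1]. Here [df1^c = r1^-1 a df a] and
    [df1 = r1 g1 df^c g1], so the sandwich by [gh] is the one that [refl_fourth] expands. *)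
Lemma fourth_darboux :
  is_darboux r2 f1 (darboux_christoffel r1 f fc f1)
    (fun p => f p + fourth_vec r1 r2 (f1 p - f p) (f2 p - f p)).
Proof.
pose w p := fourth_denom r1 r2 (f1 p - f p) (f2 p - f p).
have g1S := darboux_diff_smooth f1D; have g2S := darboux_diff_smooth f2D.
have wS : smooth_map w.
  by apply: smooth_mapB; apply: smooth_mapZ; apply: smooth_map_vec_inv.
have ghS : smooth_map (fun p =>
    fourth_vec r1 r2 (f1 p - f p) (f2 p - f p) - (f1 p - f p)).
  by apply: smooth_mapB => //; apply: smooth_mapZ; exact: smooth_map_vec_inv.
eexists; split; [exact: ghS | move=> c z ca cz X | move=> p]; last first.
  move=> /=; move: (fourth_vec _ _ _ _) => h.
  by apply/rowP => i; rewrite !mxE; ring.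
have dg1 := darboux_diff_dmap f1D X ca cz.
have dg2 := darboux_diff_dmap f2D X ca cz.
rewrite /= /cl_dform -cl_refl -cl_vecZ -cl_vecB; congr cl_vec.
rewrite (christoffel_dform fcS f1D) // (darboux_dform fS f1D) //.
rewrite reflZr scalerA.
set p := chart_inv c z in dg1 dg2 *.
have da := is_dmapZ r2 (is_dmap_vec_inv (f1f p) dg1).
have db := is_dmapZ (- r1) (is_dmap_vec_inv (f2f p) dg2).
have dw := is_dmapD da db.
have dwE : (fun y => r2 *: vec_inv (f1 (chart_inv c y) - f (chart_inv c y)) +
    - r1 *: vec_inv (f2 (chart_inv c y) - f (chart_inv c y))) = w \o chart_inv c.
  by apply/funext => y; rewrite scaleNr.
rewrite dwE in dw.
have dgh := is_dmapD (is_dmapZ (r2 - r1) (is_dmap_vec_inv (w_neq0 p) dw))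
  (is_dmapZ (-1) dg1).
have ghE : (fun y => (r2 - r1) *: vec_inv ((w \o chart_inv c) y) +
    (-1) *: (f1 (chart_inv c y) - f (chart_inv c y))) =
    (fun q => fourth_vec r1 r2 (f1 q - f q) (f2 q - f q) - (f1 q - f q))
      \o chart_inv c.
  by apply/funext => y /=; rewrite scaleN1r.
rewrite ghE in dgh; etransitivity; first exact: dmapE dgh.
rewrite refl_fourth // !reflB !reflZr !reflK // -/(w p).
rewrite -[f1 (chart_inv c z)]/(f1 p) -[f (chart_inv c z)]/(f p).
set u := vec_inv (f1 p - f p); set v := vec_inv (f2 p - f p).
(* In [dw] the two multiples of [df^c] are [- r2 r1] and [r1 r2], and cancel. *)
have -> : r2 *: - (r1 *: dform fc c z X - refl u (dform f c z X)) +
    - r1 *: - (r2 *: dform fc c z X - refl v (dform f c z X)) =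
    r2 *: refl u (dform f c z X) - r1 *: refl v (dform f c z X).
  move: (refl u _) (refl v _) => U V.
  by apply/rowP => i; rewrite !mxE; ring.
rewrite -[(w \o chart_inv c) z]/(w p) (reflB (vec_inv (w p))).
rewrite !(reflZr _ (vec_inv (w p))).
move: (refl (vec_inv (w p)) (refl u _)) (refl (vec_inv (w p)) (refl v _)) => U V.
move: (refl _ (dform fc c z X)) => W.
by apply/rowP => i; rewrite !mxE; ring.
Qed.

End FourthSurface.
End Bianchi.

(** * Concircularity and the cross-ratio *)

Section Concircularity.
Variables (R : realType) (n : nat).
Implicit Types u v w x y : 'rV[R]_n.

Lemma concircular_line (p u x1 x2 x3 : 'rV[R]_n) (t1 t2 t3 : R) :
  u != 0 -> x1 = t1 *: u -> x2 = t2 *: u -> x3 = t3 *: u ->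
  concircular p (p + x1) (p + x2) (p + x3).
Proof.
move=> u0 -> -> ->; exists [set p + t *: u | t in [set: R]]; split.
  by right; exists p, u.
by split; [exists 0; rewrite ?scale0r ?addr0 | exists t1 | exists t2 | exists t3].
Qed.

(** The equation [x.x = 2 x.c] says [|x - c| = |c|]: relative to [p], the centre is [c], and the
    radius [|c|] is positive. The pair [u], [v] is an orthonormal basis of the plane of the
    circle. *)
Lemma concircular_circle (p u v c x1 x2 x3 : 'rV[R]_n) :
  dot u u = 1 -> dot v v = 1 -> dot u v = 0 -> c != 0 ->
  let on_circle x := x = dot x u *: u + dot x v *: v /\ dot x x = 2 * dot x c in
  c = dot c u *: u + dot c v *: v ->
  on_circle x1 -> on_circle x2 -> on_circle x3 ->
  concircular p (p + x1) (p + x2) (p + x3).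
Proof.
move=> uu vv uv c0 on_circle cE h1 h2 h3.
have planeE x y : x = dot x u *: u + dot x v *: v ->
    dot x y = dot x u * dot y u + dot x v * dot y v.
  by move=> xE; rewrite {1}xE dotDl !dotZl !(dotC y).
have rho2 : Num.sqrt (dot c c) ^+ 2 = dot c c.
  by rewrite sqr_sqrtr // ltW // dot_gt0.
exists [set p + c + s.1 *: u + s.2 *: v |
  s in [set s : R * R | s.1 ^+ 2 + s.2 ^+ 2 = Num.sqrt (dot c c) ^+ 2]]; split.
  left; exists (p + c), u, v, (Num.sqrt (dot c c)).
  by split=> //; rewrite sqrtr_gt0 dot_gt0.
have onA x : on_circle x ->
    [set p + c + s.1 *: u + s.2 *: v |
     s in [set s : R * R | s.1 ^+ 2 + s.2 ^+ 2 = Num.sqrt (dot c c) ^+ 2]] (p + x).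
  move=> [xE xc]; exists (dot x u - dot c u, dot x v - dot c v) => /=.
    move: xc; rewrite rho2 (planeE _ x xE) (planeE _ c xE) (planeE _ c cE) => xc.
    transitivity ((dot x u * dot x u + dot x v * dot x v) -
      2 * (dot x u * dot c u + dot x v * dot c v) +
      (dot c u * dot c u + dot c v * dot c v)); first by ring.
    by rewrite xc; ring.
  rewrite [in RHS]xE [in X in p + X]cE.
  move: (dot x u) (dot x v) (dot c u) (dot c v) => *.
  by apply/rowP => i; rewrite !mxE; ring.
split; try exact: onA.
(* The base point corresponds to [x = 0]. *)
by rewrite -[X in _ X]addr0; apply: onA; split; rewrite !dot0l ?scale0r ?addr0 ?mulr0.
Qed.

(* A circle through the origin is x.x = 2 x.c; for x = vec_inv y this is the
   affine condition y.c = -1/2, and fourth_vec is the inverse of an affine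
   combination of the inverses of g1 and g2. *)
Lemma concircular_fourth (p g1 g2 : 'rV[R]_n) (r1 r2 : R) :
  g1 != 0 -> g2 != 0 -> fourth_denom r1 r2 g1 g2 != 0 ->
  concircular p (p + g1) (p + fourth_vec r1 r2 g1 g2) (p + g2).
Proof.
move=> g10 g20 w0.
(* Gram-Schmidt on [g1], [g2] gives [g1 = l u] and [g2 = (g2.u) u + k v], unless the two are
   parallel. *)
have N0 := dot_gt0 g10; pose l := Num.sqrt (dot g1 g1).
have l0 : l != 0 by rewrite gt_eqF // sqrtr_gt0.
have l2 : l * l = dot g1 g1 by rewrite -expr2 sqr_sqrtr // ltW.
pose u := l^-1 *: g1.
have g1u : g1 = l *: u by rewrite scalerA mulfV // scale1r.
have uu : dot u u = 1 by rewrite dotZl dotZr -l2; field.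
have u0 : u != 0 by rewrite -dot_eq0 uu oner_neq0.
clearbody u l.
pose e := g2 - dot g2 u *: u.
have g2e : g2 = dot g2 u *: u + e by rewrite addrC subrK.
(* Parallel [g1] and [g2]: all four points lie on the line through [p] along [u]. *)
have [e0|e0] := eqVneq e 0.
  move: g2e; rewrite e0 addr0; move: (dot g2 u) => m g2u.
  apply: (concircular_line p u0 g1u _ g2u).
  rewrite /fourth_vec /fourth_denom g1u g2u (vec_invZ l) (vec_invZ m).
  rewrite (scalerA r2) (scalerA r1) -scalerBl vec_invZ vec_invK.
  exact: scalerA.
have E0 := dot_gt0 e0; pose k := Num.sqrt (dot e e).
have k0 : k != 0 by rewrite gt_eqF // sqrtr_gt0.
have k2 : k * k = dot e e by rewrite -expr2 sqr_sqrtr // ltW.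
pose v := k^-1 *: e.
have eu : dot e u = 0 by rewrite dotDl dotNl dotZl uu mulr1 subrr.
clearbody e.
have ev : e = k *: v by rewrite scalerA mulfV // scale1r.
have vv : dot v v = 1 by rewrite dotZl dotZr -k2; field.
have uv : dot u v = 0 by rewrite dotZr dotC eu mulr0.
clearbody v k.
have vu : dot v u = 0 by rewrite dotC.
pose plane x := x = dot x u *: u + dot x v *: v.
have planeB x y : plane x -> plane y -> plane (x - y).
  move=> xE yE; rewrite /plane !dotDl !dotNl [in LHS]xE [in LHS]yE.
  move: (dot x u) (dot x v) (dot y u) (dot y v) => *.
  by apply/rowP => i; rewrite !mxE; ring.
have planeZ a x : plane x -> plane (a *: x).
  move=> xE; rewrite /plane !dotZl [in LHS]xE.
  by rewrite scalerDr !scalerA.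
have plane_g1 : plane g1.
  by rewrite /plane g1u !dotZl uu uv mulr0 mulr1 scale0r addr0.
have g2v : dot g2 v = k.
  by rewrite g2e dotDl dotZl uv mulr0 add0r ev dotZl vv mulr1.
have plane_g2 : plane g2 by rewrite /plane g2v -ev.
(* The circumcentre of [0], [g1], [g2]: its coordinates solve [g1.g1 = 2 g1.c] and
   [g2.g2 = 2 g2.c]. *)
pose c := (l / 2) *: u +
  ((dot g2 u * dot g2 u + k * k - dot g2 u * l) / (2 * k)) *: v.
have cu : dot c u = l / 2 by rewrite dotDl !dotZl uu vu mulr0 addr0 mulr1.
have g1c : dot g1 g1 = 2 * dot g1 c.
  by rewrite [in RHS]g1u dotZl (dotC u) cu -l2; field.
have g2c : dot g2 g2 = 2 * dot g2 c.
  rewrite {1}plane_g2 dotDl !dotZl (dotC u) (dotC v) dotDr !dotZr g2v.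
  by move: (dot g2 u) => m; field.
have invc x : x != 0 -> dot x x = 2 * dot x c -> dot (vec_inv x) c = - 2^-1.
  rewrite -dot_eq0 => x0 xc; rewrite dotZl mulNr.
  have -> : dot x c = 2^-1 * dot x x by rewrite xc; field.
  by field.
set w := fourth_denom r1 r2 g1 g2 in w0 *.
have plane_w : plane w by apply: planeB; exact/planeZ/planeZ.
(* The numerator [r2 - r1] of [fourth_vec] is exactly what brings the inverse of [w] back to the
   circle. *)
have wc : dot w c = - (r2 - r1) / 2.
  by rewrite /w /fourth_denom dotDl dotNl (dotZl r2) (dotZl r1) !invc //; field.
have h_on : plane (fourth_vec r1 r2 g1 g2) by exact/planeZ/planeZ.
have hc : dot (fourth_vec r1 r2 g1 g2) (fourth_vec r1 r2 g1 g2) =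
    2 * dot (fourth_vec r1 r2 g1 g2) c.
  rewrite /fourth_vec -/w /vec_inv !dotZl !dotZr wc.
  have : dot w w != 0 by rewrite dot_eq0.
  by move: (dot w w) => t t0; field.
apply: (@concircular_circle p u v c) => //.
  apply/negP => /eqP c0; move: cu; rewrite c0 dot0l => /esym/eqP.
  by rewrite mulf_eq0 (negPf l0) invr_eq0 pnatr_eq0.
rewrite /c !dotDl !dotZl uu vv uv vu.
by rewrite !mulr0 !mulr1 addr0 add0r.
Qed.

(** With [h = fourth_vec] and its symmetry, [fourth_vec_mul] evaluates both [(h - g1) g1^-1] and
    [(h - g2) g2^-1] as multiples of [w^-1 (b - a)], by [r1] and [r2]. Substituting the second for
    the first makes the cross-ratio telescope. *)
Lemma cross_ratio_fourth (p g1 g2 : 'rV[R]_n) (r1 r2 : R) :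
  r1 != 0 -> r2 != 0 -> g1 != 0 -> g2 != 0 -> g1 != g2 ->
  fourth_denom r1 r2 g1 g2 != 0 ->
  cross_ratio p (p + g1) (p + fourth_vec r1 r2 g1 g2) (p + g2) = (r2 / r1)%:A.
Proof.
move=> r10 r20 g10 g20 g12 w0.
have w0' : fourth_denom r2 r1 g2 g1 != 0 by rewrite fourth_denomC oppr_eq0.
have gh0 := fourth_vec_neq r10 g10 w0 g12.
rewrite /cross_ratio.
have -> : p - (p + g1) = - g1 by rewrite opprD addNKr.
have -> : p + g1 - (p + fourth_vec r1 r2 g1 g2) = - (fourth_vec r1 r2 g1 g2 - g1).
  by rewrite opprB opprD addrACA subrr add0r.
have -> : p + fourth_vec r1 r2 g1 g2 - (p + g2) = fourth_vec r1 r2 g1 g2 - g2.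
  by rewrite opprD addrACA subrr add0r.
have -> : p + g2 - p = g2 by rewrite addrC addKr.
have m1 := fourth_vec_mul g10 w0.
have m2 := fourth_vec_mul g20 w0'.
rewrite fourth_vecC fourth_denomC cl_vecN invrN mulNr -mulrN opprB in m2.
move: gh0; rewrite -subr_eq0 => /cl_vec_unit ghU.
have g1U := cl_vec_unit g10.
rewrite (cl_vec_inv g20) !cl_vecN invrN mulrNN -mulrA m2.
have -> : r2 *: ((cl_vec (fourth_denom r1 r2 g1 g2))^-1 *
    (cl_vec (vec_inv g2) - cl_vec (vec_inv g1))) =
    (r2 / r1) *: (cl_vec (fourth_vec r1 r2 g1 g2 - g1) * cl_vec (vec_inv g1)).
  by rewrite m1 scalerA divfK.
by rewrite -scalerAr mulrA (mulrVK ghU) -(cl_vec_inv g10) (divrr g1U).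
Qed.

End Concircularity.

(** Here [M] stands for the open set to which the surface has been shrunk, so the nonvanishing
    conditions are imposed at every point. *)
Theorem theorem2p19 (R : realType) (n : nat)
  (M : riemannSurface R) (Q : quadDiff M) (Q_neq0 : quad_nonzero Q)
  (f fc : M -> 'rV[R]_n)
  (f_isothermic : isothermic Q f) (f_christoffel : is_christoffel Q f fc)
  (r1 r2 : R) (r1_neq0 : r1 != 0) (r2_neq0 : r2 != 0)
  (f1 f2 : M -> 'rV[R]_n)
  (f1_darboux : is_darboux r1 f fc f1) (f2_darboux : is_darboux r2 f fc f2)
  (f1_neq_f : forall p, f1 p - f p != 0)
  (f2_neq_f : forall p, f2 p - f p != 0)
  (f1_neq_f2 : forall p, f1 p - f2 p != 0)
  (finite_fhat : forall p,
     r2 *: (cl_vec (f1 p - f p))^-1 - r1 *: (cl_vec (f2 p - f p))^-1 != 0) :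
  exists fhat : M -> 'rV[R]_n,
    [/\ isothermic Q fhat,
        is_darboux r2 f1 (darboux_christoffel r1 f fc f1) fhat,
        is_darboux r1 f2 (darboux_christoffel r2 f fc f2) fhat &
        forall p, concircular (f p) (f1 p) (fhat p) (f2 p) /\
                  cross_ratio (f p) (f1 p) (fhat p) (f2 p) = (r2 / r1)%:A].
Proof.
(* The Clifford element of [finite_fhat] is the image of the vector [fourth_denom]. *)
have w_neq0 p : fourth_denom r1 r2 (f1 p - f p) (f2 p - f p) != 0.
  apply: contraNneq (finite_fhat p) => w0; rewrite !cl_vec_inv //.
  rewrite -!cl_vecZ -cl_vecB -/(fourth_denom _ _ _ _) w0.
  by rewrite -(scale0r 0) cl_vecZ scale0r.
have [[fS _] _] := f_isothermic; have [fcS _ _] := f_christoffel.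
have hat1 := fourth_darboux fS fcS r1_neq0 f1_darboux f2_darboux f1_neq_f
  f2_neq_f w_neq0.
exists (fun p => f p + fourth_vec r1 r2 (f1 p - f p) (f2 p - f p)).
have g12 p : f1 p - f p != f2 p - f p.
  by rewrite -subr_eq0 opprB subrKA.
have fhat_neq_f1 p :
    f p + fourth_vec r1 r2 (f1 p - f p) (f2 p - f p) - f1 p != 0.
  have := fourth_vec_neq r1_neq0 (f1_neq_f p) (w_neq0 p) (g12 p).
  by rewrite -subr_eq0 opprB addrA [_ + f p]addrC.
split.
- exact: darboux_twice_isothermic r1_neq0 r2_neq0 f_isothermic f_christoffel
    f1_darboux f1_neq_f hat1 fhat_neq_f1.
- exact: hat1.
(* The same lemma with the transforms exchanged yields the same surface, by [fourth_vecC]. *)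
- have w_neq0' p : fourth_denom r2 r1 (f2 p - f p) (f1 p - f p) != 0.
    by rewrite fourth_denomC oppr_eq0.
  have := fourth_darboux fS fcS r2_neq0 f2_darboux f1_darboux f2_neq_f
    f1_neq_f w_neq0'.
  by under eq_fun do rewrite fourth_vecC.
- move=> p.
  have := concircular_fourth (f p) (f1_neq_f p) (f2_neq_f p) (w_neq0 p).
  have := cross_ratio_fourth (f p) r1_neq0 r2_neq0 (f1_neq_f p) (f2_neq_f p)
    (g12 p) (w_neq0 p).
  by rewrite !subrKC.
Qed.
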